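(* Let $q$ be a prime power, let $\xi\in\mathbb{F}_{q^4}$ be an element of degree $4$ over $\mathbb{F}_q$, let $R$ be a positive integer, and let $\alpha_1,\ldots,\alpha_R\in\mathbb{F}_{q^4}^*$. Consider the matrix $A\in\mathbb{F}_{q^4}^{10\times R}$ and, for every $i\in\{0,1,2,3\}$, the vector $b_i\in\mathbb{F}_{q^4}^{10}$ defined by $$A=\begin{pmatrix} \alpha_1^2 & \alpha_2^2 & \cdots & \alpha_R^2\\ \alpha_1^{2q} & \alpha_2^{2q} & \cdots & \alpha_R^{2q}\\ \alpha_1^{2q^2} & \alpha_2^{2q^2} & \cdots & \alpha_R^{2q^2}\\ \alpha_1^{2q^3} & \alpha_2^{2q^3} & \cdots & \alpha_R^{2q^3}\\ \alpha_1^{q+1} & \alpha_2^{q+1} & \cdots & \alpha_R^{q+1}\\ \alpha_1^{q^2+q} & \alpha_2^{q^2+q} & \cdots & \alpha_R^{q^2+q}\\ \alpha_1^{q^3+q^2} & \alpha_2^{q^3+q^2} & \cdots & \alpha_R^{q^3+q^2}\\ \alpha_1^{q^3+1} & \alpha_2^{q^3+1} & \cdots & \alpha_R^{q^3+1}\\ \alpha_1^{q^2+1} & \alpha_2^{q^2+1} & \cdots & \alpha_R^{q^2+1}\\ \alpha_1^{q^3+q} & \alpha_2^{q^3+q} & \cdots & \alpha_R^{q^3+q} \end{pmatrix},\qquad b_i=\begin{pmatrix}\xi^i\\ \xi^{iq}\\ \xi^{iq^2}\\ \xi^{iq^3}\\0\\0\\0\\0\\0\\0\end{pmatrix}.$$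 If, for every $i\in\{0,1,2,3\}$, the linear system $AX=b_i$ admits a solution $X\in\mathbb{F}_q^R$, then $\mu_q^{\mathrm{sym}}(4)\leq R$. Moreover, the elements $\alpha_1,\ldots,\alpha_R$ yield the symmetric tensor decomposition $$\left\{\alpha_1\operatorname{Tr}_{q^4/q}(\alpha_1x),\ldots,\alpha_R\operatorname{Tr}_{q^4/q}(\alpha_Rx)\right\}$$ of $M_{q^4}$, that is, the $\mathbb{F}_q$-span of this set contains $\langle x\rangle_{\mathbb{F}_{q^4}}$.
   Context: For a positive integer $m$, the symmetric tensor rank $\mu_q^{\mathrm{sym}}(m)$ of the multiplication map $M_{q^m}:\mathbb{F}_{q^m}\times\mathbb{F}_{q^m}\to\mathbb{F}_{q^m}$, $(\alpha,\beta)\mapsto\alpha\beta$, is the smallest integer $R$ for which there exist $\mathbb{F}_q$-linear forms $\phi_1,\ldots,\phi_R:\mathbb{F}_{q^m}\to\mathbb{F}_q$ and elements $w_1,\ldots,w_R\in\mathbb{F}_{q^m}$ with $\alpha\beta=\sum_{i=1}^R\phi_i(\alpha)\phi_i(\beta)w_i$ for all $\alpha,\beta\in\mathbb{F}_{q^m}$. $\operatorname{Tr}_{q^m/q}(x)=\sum_{j=0}^{m-1}x^{q^j}$ is the field trace. Linearized polynomials $\sum_{i=0}^{m-1}a_ix^{q^i}$ with $a_i\in\mathbb{F}_{q^m}$ (taken modulo $x^{q^m}-x$) are identified with $\mathbb{F}_q$-linear maps on $\mathbb{F}_{q^m}$, and $\langle x\rangle_{\mathbb{F}_{q^m}}=\{ax:a\in\mathbb{F}_{q^m}\}$.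 *)

(* Defs.v *)
From HB Require Import structures.
From mathcomp Require Import all_boot all_algebra all_field.
From mathcomp Require Import boolp ring.

Set Implicit Arguments.
Unset Strict Implicit.
Unset Printing Implicit Defensive.

Import GRing.Theory.
Local Open Scope ring_scope.

(* F is the field with q = #|F| elements; its extension of degree m is an     *)
(* arbitrary L : fieldExtType F with \dim {:L} = m, unique up to isomorphism. *)

Section SymmetricTensorRank.
Variables (F : finFieldType) (L : fieldExtType F).

Definition has_sym_decomp (R : nat) : Prop :=
  exists (phi : 'I_R -> 'Hom(L, F^o)) (w : 'I_R -> L),
    forall a b : L, a * b = \sum_(i < R) (phi i a * phi i b) *: w i.

Let lin (s : seq ('Hom(L, F^o) * L)) (a : L) : L :=
  \sum_(p <- s) (p.1 a : F) *: p.2.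

Let bil (s : seq ('Hom(L, F^o) * L)) (a b : L) : L :=
  \sum_(p <- s) (p.1 a * p.1 b : F) *: p.2.

Let polarization (x y x' y' : F) (e d : L) :
  (x *: e) * (y' *: d) + (y *: d) * (x' *: e)
  = ((x + y) * (x' + y')) *: (e * d) + (x * x') *: - (e * d)
    + (y * y') *: - (e * d).
Proof.
rewrite -!scalerAl -!scalerAr !scalerA (mulrC d e) !scalerN -!scalerBl -scalerDl.
by congr (_ *: _); ring.
Qed.

Let bil_polarized f e s :
  exists u, forall a b : L,
    ((f : 'Hom(L, F^o)) a : F) *: e * lin s b + lin s a * ((f b : F) *: e)
    = bil u a b.
Proof.
elim: s => [|[g d] s [u IHs]].
  by exists [::] => a b; rewrite /bil /lin !big_nil mulr0 mul0r addr0.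
exists [:: (f + g, e * d), (f, - (e * d)), (g, - (e * d)) & u] => a b.
rewrite /bil /lin !big_cons /= -/(bil u a b) -/(lin s a) -/(lin s b) -IHs.
rewrite !add_lfunE mulrDr mulrDl addrACA.
by rewrite (polarization (f a) (g a) (f b) (g b)) !addrA.
Qed.

Let bil_lin s : exists t, forall a b : L, lin s a * lin s b = bil t a b.
Proof.
elim: s => [|[f e] s [t IHs]].
  by exists [::] => a b; rewrite /bil /lin !big_nil mul0r.
have [u Hu] := bil_polarized f e s.
exists ((f, e * e) :: u ++ t) => a b.
rewrite /lin /bil !big_cons big_cat /= -/(lin s a) -/(lin s b).
rewrite -/(bil u a b) -/(bil t a b) -Hu -IHs mulrDl !mulrDr -!addrA.
by congr (_ + _); rewrite -scalerAl -scalerAr scalerA.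
Qed.

Lemma has_sym_decomp_ex : exists R, `[< has_sym_decomp R >].
Proof.
pose X := vbasis {:L}.
have [t Ht] := bil_lin [seq (linfun (coord X i : L -> F^o), X`_i) | i : 'I_(\dim {:L})].
have linE (a : L) : a = lin [seq (linfun (coord X i : L -> F^o), X`_i) | i <- enum 'I__] a.
  rewrite {1}(coord_vbasis (memvf a)) /lin big_image /=.
  by apply: eq_bigr => i _; rewrite lfunE.
exists (size t); apply/asboolP.
exists (fun i => (nth (0, 0) t i).1), (fun i => (nth (0, 0) t i).2) => a b.
by rewrite {1}[a]linE {1}[b]linE Ht /bil (big_nth (0, 0)) big_mkord.
Qed.

(* The rank mu_q^sym(m) for q = #|F| and m = \dim {:L}.                       *)
Definition sym_tensor_rank : nat := ex_minn has_sym_decomp_ex.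

End SymmetricTensorRank.

Section Trace.
Variables (F : finFieldType) (L : fieldExtType F).

Definition trace (x : L) : L := \sum_(j < \dim {:L}) x ^+ (#|F| ^ j)%N.

Definition mul_trace_mul (c x : L) : L := c * trace (c * x).

Let frob_linear j : linear (fun x : L => x ^+ (#|F| ^ j)%N).
Proof.
have [p p_pr pF] := finPcharP F.
have pL : p \in [pchar L] by rewrite pchar_lalg.
move=> k x y /=; rewrite exprDn_pchar.
  rewrite exprZn; congr (_ *: _ + _).
  by elim: j => [|j IHj]; rewrite ?expr1 // expnS exprM expf_card.
by rewrite (card_pprimeChar pF) (eq_pnat _ (pcharf_eq pL)) !pnatX pnat_id.
Qed.

Lemma trace_is_linear : linear trace.
Proof.
move=> k x y; rewrite /trace scaler_sumr -big_split; apply: eq_bigr => j _.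
exact: frob_linear.
Qed.

Lemma mul_trace_mul_is_linear c : linear (mul_trace_mul c).
Proof.
move=> k x y; rewrite /mul_trace_mul mulrDr -scalerAr trace_is_linear.
by rewrite mulrDr -scalerAr.
Qed.

HB.instance Definition _ c := GRing.isLinear.Build F L L *:%R
  (mul_trace_mul c) (mul_trace_mul_is_linear c).

Definition trace_map (c : L) : 'End(L) := linfun (mul_trace_mul c).

Lemma trace_mapE c x : trace_map c x = c * trace (c * x).
Proof. by rewrite lfunE. Qed.

End Trace.

Section System.
Variables (F : finFieldType) (L : fieldExtType F).
Let q := #|F|.

Definition exponents : seq nat :=
  [:: 2; 2 * q; 2 * q ^ 2; 2 * q ^ 3;
      q + 1; q ^ 2 + q; q ^ 3 + q ^ 2; q ^ 3 + 1; q ^ 2 + 1; q ^ 3 + q]%N.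

Definition system_mx (R : nat) (alpha : 'I_R -> L) : 'M[L]_(10, R) :=
  \matrix_(k < 10, j < R) alpha j ^+ nth 0%N exponents k.

Definition system_rhs (xi : L) (i : nat) : 'cV[L]_10 :=
  \col_(k < 10) if (k < 4)%N then xi ^+ (i * q ^ k)%N else 0.

End System.

(* Main.v *)
From HB Require Import structures.
Require Import Defs.
From mathcomp Require Import all_boot all_algebra all_field.
From mathcomp Require Import boolp.

(** The map [x |-> sum_j X_j alpha_j Tr (alpha_j x)] is the linearized
    polynomial whose coefficient at [x ^+ (q ^ k)] is
    [sum_j X_j alpha_j ^ (1 + q ^ k)]  ([sum_trace_map]).  Four rows of the
    system, those of exponents [2], [q + 1], [q ^ 2 + 1] and [q ^ 3 + 1], say
    that this polynomial is [xi ^ i x]; so multiplication by [xi ^ i] lies in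
    the span of the maps [alpha_j Tr (alpha_j x)].  As [1, xi, xi^2, xi^3] is
    a basis of [L], multiplication by any [a] does
    ([amull_in_of_powers]).

    The rank bound follows from the span condition alone
    ([span_trace_map_sym_decomp]).  Write [T_j x = Tr (alpha_j x)], a scalar,
    and suppose [a z = sum_j X_j(a) alpha_j T_j z] for all [a] and [z].
    Multiplying by [y] and taking traces gives
    [T_j (x y) = sum_k X_k(alpha_j) T_k x T_k y], an expression of [T_j (x y)]
    that is symmetric in [x] and [y].  Substituting it in
    [x y = sum_j X_j(1) alpha_j T_j (x y)] yields
    [x y = sum_k T_k x T_k y w_k] with
    [w_k = sum_j X_j(1) X_k(alpha_j) alpha_j]. *)

Set Implicit Arguments.
Unset Strict Implicit.
Unset Printing Implicit Defensive.

Import GRing.Theory.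
Local Open Scope ring_scope.

Section TraceForm.
Variables (F : finFieldType) (L : fieldExtType F).

HB.instance Definition _ := GRing.isLinear.Build F L L *:%R
  (@trace F L) (@trace_is_linear F L).

Lemma expf_card_ext (x : L) : x ^+ (#|F| ^ \dim {:L})%N = x.
Proof. by apply/eqP; rewrite -Fermat's_little_theorem memvf. Qed.

(** Raising to the power [q] permutes the conjugates [x ^+ (q ^ j)]
    cyclically, so it fixes their sum. *)
Lemma trace_in_base (x : L) : trace x \in 1%AS.
Proof.
rewrite Fermat's_little_theorem dimv1 expn1.
have [p p_pr pF] := finPcharP F.
have pL : p \in [pchar L] by rewrite pchar_lalg.
have qL : [pchar L].-nat #|F|.
  by rewrite (card_pprimeChar pF) (eq_pnat _ (pcharf_eq pL)) !pnatX pnat_id.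
have q0 : (0 : L) ^+ #|F| = 0.
  by rewrite expr0n -leqn0 leqNgt (ltnW (finRing_gt1 F)).
rewrite /trace (big_morph (fun y : L => y ^+ #|F|)
  (fun y z => exprDn_pchar y z qL) q0).
have : \dim {:L} != 0%N by rewrite -lt0n adim_gt0.
case def_m: (\dim {:L}) => [//|m] _.
rewrite big_ord_recr [X in _ == X]big_ord_recl /= -exprM -expnSr -def_m.
rewrite expf_card_ext expr1 addrC; apply/eqP; congr (_ + _).
by apply: eq_bigr => j _; rewrite -exprM -expnSr.
Qed.

(** [trace] is valued in [L]; its coordinate on the line spanned by [1], which
    contains all traces, is the same trace as a scalar. *)
Definition trace_form (c : L) : 'Hom(L, F^o) :=
  (linfun (coord [tuple 1 : L] ord0 : L -> F^o) \o linfun (@trace F L)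
    \o amull c)%VF.

Lemma trace_formE c x : (trace_form c x : F) *: 1 = trace (c * x) :> L.
Proof.
rewrite /trace_form !comp_lfunE !lfunE /=.
have: trace (c * x) \in <<[tuple 1%R : L]>>%VS.
  by rewrite span_seq1; apply: trace_in_base.
by move/coord_span => {2}->; rewrite big_ord1.
Qed.

Lemma trace_map_form c x : trace_map c x = (trace_form c x : F) *: c.
Proof. by rewrite trace_mapE -trace_formE -scalerAr mulr1. Qed.

Lemma trace_form_comm c x : trace_form c x = trace_form x c.
Proof.
apply: (fmorph_inj (in_alg L)).
by rewrite /= !trace_formE mulrC.
Qed.

Lemma sum_trace_map (R : nat) (alpha : 'I_R -> L) (X : 'I_R -> F) (x : L) :
  \sum_j X j *: trace_map (alpha j) x =
  \sum_(k < \dim {:L})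
     (\sum_j X j *: alpha j ^+ (#|F| ^ k + 1)%N) * x ^+ (#|F| ^ k)%N.
Proof.
under [RHS]eq_bigr do rewrite mulr_suml.
rewrite exchange_big; apply: eq_bigr => j _ /=.
rewrite trace_mapE /trace mulr_sumr scaler_sumr; apply: eq_bigr => k _.
by rewrite exprMn -scalerAl addn1 exprS mulrA.
Qed.

Lemma span_trace_mapP (R : nat) (alpha : 'I_R -> L) (f : 'End(L)) :
  f \in <<[seq trace_map (alpha j) | j : 'I_R]>>%VS <->
  exists X : 'I_R -> F, f = \sum_j X j *: trace_map (alpha j).
Proof.
split=> [|[X ->]]; last first.
  apply: memv_suml => j _; apply/memvZ/memv_span.
  by apply/imageP; exists j.
rewrite span_def big_image /= => /memv_sumP[g g_in ->].
have /choice[X gX] (j : 'I_R) : exists k : F, g j = k *: trace_map (alpha j).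
  by have /vlineP := g_in j isT.
by exists X; apply: eq_bigr => j _.
Qed.

(** The expansion of [a z] in the [trace_map (alpha j)] treats [a] and [z]
    differently.  The trace of [a z y], for a fixed [a], is instead a diagonal
    form in [z] and [y], hence symmetric; it is used with [a] equal to each [alpha j]. *)
Lemma span_trace_map_sym_decomp (R : nat) (alpha : 'I_R -> L) :
  (forall a : L,
     amull a \in <<[seq trace_map (alpha j) | j : 'I_R]>>%VS) ->
  has_sym_decomp L R.
Proof.
move=> span_alpha.
have /choice[X mulX] (a : L) : exists X : 'I_R -> F,
    amull a = \sum_j X j *: trace_map (alpha j).
  exact/span_trace_mapP.
have mulE a z : a * z = \sum_j X a j *: ((trace_form (alpha j) z : F) *: alpha j).
  rewrite -[LHS](lfunE (a \*o idfun)) -/(amull a) mulX sum_lfunE.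
  by apply: eq_bigr => j _; rewrite scale_lfunE trace_map_form.
have formM j (x y : L) : trace_form (alpha j) (x * y) =
    \sum_k X (alpha j) k *:
      (trace_form (alpha k) x * trace_form (alpha k) y : F^o).
  (* Both sides are the trace of alpha_j x y. *)
  have -> : trace_form (alpha j) (x * y) = trace_form y (alpha j * x).
    apply: (fmorph_inj (in_alg L)).
    by rewrite /= !trace_formE mulrA [y * _]mulrC.
  rewrite mulE linear_sum; apply: eq_bigr => k _.
  by rewrite 2!linearZ /= (trace_form_comm y).
exists (fun k => trace_form (alpha k)).
exists (fun k => \sum_j (X 1 j * X (alpha j) k) *: alpha j) => x y.
rewrite -[LHS]mul1r mulE.
under eq_bigr do rewrite formM scaler_suml scaler_sumr.
rewrite exchange_big; apply: eq_bigr => k _ /=.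
rewrite scaler_sumr; apply: eq_bigr => j _.
by rewrite scalerA [RHS]scalerA [in RHS]mulrC -mulrA.
Qed.

End TraceForm.

Section Powers.
Variables (F : fieldType) (L : fieldExtType F).

Lemma Fadjoin_full (xi : L) :
  adjoin_degree 1%AS xi = \dim {:L} -> <<1; xi>>%VS = fullv.
Proof.
move=> deg_xi; apply/eqP.
by rewrite eqEdim subvf /= dim_Fadjoin deg_xi dimv1 muln1.
Qed.

Lemma amull_in_of_powers (xi : L) (U : {vspace 'End(L)}) :
  adjoin_degree 1%AS xi = \dim {:L} ->
  (forall i : 'I_(\dim {:L}), amull (xi ^+ i) \in U) ->
  forall a : L, amull a \in U.
Proof.
move=> deg_xi powU a.
have: a \in <<1; xi>>%VS by rewrite Fadjoin_full ?memvf.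
move/Fadjoin_poly_eq => <-.
have szp := size_Fadjoin_poly 1%AS xi a.
rewrite (horner_coef_wide _ szp) linear_sum; apply: memv_suml => i _.
have /polyOverP/(_ i)/vlineP[k ->] := Fadjoin_polyOver 1%AS xi a.
rewrite -scalerAl mul1r linearZ memvZ //.
by have := powU (cast_ord deg_xi i).
Qed.

End Powers.

Theorem theorem4p6 (F : finFieldType) (L : fieldExtType F)
    (dimL : \dim {:L} = 4%N)
    (xi : L) (deg_xi : adjoin_degree 1%AS xi = 4%N)
    (R : nat) (R_gt0 : (0 < R)%N)
    (alpha : 'I_R -> L) (alpha_neq0 : forall j, alpha j != 0)
    (solvable : forall i : 'I_4, exists X : 'cV[F]_R,
       system_mx alpha *m map_mx (in_alg L) X = system_rhs xi i) :
  (sym_tensor_rank L <= R)%N /\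
  (forall a : L,
     amull a \in <<[seq trace_map (alpha j) | j : 'I_R]>>%VS).
Proof.
have span_alpha (a : L) :
    amull a \in <<[seq trace_map (alpha j) | j : 'I_R]>>%VS.
  move: a; apply: (@amull_in_of_powers _ _ xi); first by rewrite dimL.
  rewrite dimL => i; apply/span_trace_mapP.
  have [X solX] := solvable i.
  exists (fun j => X j ord0); apply/lfunP => x.
  have row (k : 'I_10) : \sum_j X j ord0 *: alpha j ^+ nth 0%N (exponents F) k =
               system_rhs xi i k ord0.
    rewrite -solX !mxE; apply: eq_bigr => j _.
    by rewrite !mxE /= -scalerAr mulr1.
  rewrite sum_lfunE; under eq_bigr do rewrite scale_lfunE.
  (* For k = 0, 1, 2, 3, the exponent q ^ k + 1 is that of row 0, 4, 8, 7. *)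
  rewrite sum_trace_map dimL !big_ord_recl big_ord0 /=.
  have := row (inord 0); have := row (inord 4).
  have := row (inord 8); have := row (inord 7).
  rewrite !mxE !inordK //= => -> -> -> ->.
  by rewrite !mul0r !addr0 muln1 expr1 lfunE.
split=> //; rewrite /sym_tensor_rank; case: ex_minnP => m _; apply.
exact/asboolP/span_trace_map_sym_decomp/span_alpha.
Qed.
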